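(* Let $(E_0^{*,*},d,d')$ be a double cochain complex of abelian groups, and let $E_r^{*,*}$ (with differentials $d_r$) be the corresponding type II spectral sequence. For any integer $n$, define a second double cochain complex $(\tilde E_0^{*,*},\tilde d,\tilde d')$ by $\tilde E_0^{i,j}=E_0^{i,j}$, $\tilde d=d$ and $\tilde d'=nd'$, with corresponding type II spectral sequence $\tilde E_r^{*,*}$ (with differentials $\tilde d_r$). Then any element $x$ of $E_0^{*,*}$ that represents an element of $E_r^{*,*}$ also represents an element of $\tilde E_r^{*,*}$, and $\tilde d_r(x)=n^r d_r(x)$ (that is, if $y\in E_0^{*,*}$ represents $d_r(x)$, then $n^r y$ represents $\tilde d_r(x)$).
   Context: In a double cochain complex $(E_0^{*,*},d,d')$ the differentials are $d:E_0^{i,j}\to E_0^{i+1,j}$ and $d':E_0^{i,j}\to E_0^{i,j+1}$, and $d+d'$ is the differential of the total complex. The type II spectral sequence is the spectral sequence of the double complex in which $d_0=d$; its differentials are $d_r:E_r^{i,j}\to E_r^{i-r+1,j+r}$. Concretely, $x\in E_0^{i,j}$ represents an element of $E_r^{i,j}$ if there exist $x=x_1,\dots,x_r$ with $x_k\in E_0^{i-k+1,j+k-1}$, $d(x_1)=0$ and $d(x_{k+1})+d'(x_k)=0$ for $1\le k<r$, and then $d_r(x)$ is represented by $d'(x_r)$. *)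

(* Defs.v *)
From HB Require Import structures.
From mathcomp Require Import all_boot all_order all_algebra.
From mathcomp Require Import zify.
From mathcomp Require Import boolp.

Set Implicit Arguments.
Unset Strict Implicit.
Unset Printing Implicit Defensive.

Import GRing.Theory.
Local Open Scope ring_scope.
Local Open Scope quotient_scope.

(* Since d + d' is the differential of the total complex, the axioms are the
   components of (d + d')^2 = 0 in bidegrees (2, 0), (0, 2) and (1, 1); in
   particular d and d' anticommute. *)
Record double_complex := DoubleComplex {
  dplx_obj :> int -> int -> zmodType;
  dplx_d : forall i j, {additive dplx_obj i j -> dplx_obj (i + 1) j};
  dplx_d' : forall i j, {additive dplx_obj i j -> dplx_obj i (j + 1)};
  dplx_dd : forall i j (x : dplx_obj i j), dplx_d _ _ (dplx_d _ _ x) = 0;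
  dplx_d'd' : forall i j (x : dplx_obj i j), dplx_d' _ _ (dplx_d' _ _ x) = 0;
  dplx_dC : forall i j (x : dplx_obj i j),
    dplx_d _ _ (dplx_d' _ _ x) + dplx_d' _ _ (dplx_d _ _ x) = 0
}.

Local Notation d := (@dplx_d _ _ _).
Local Notation d' := (@dplx_d' _ _ _).

Section Rescale.
Variables (n : int) (E : double_complex).

Definition rescale_d' i j (x : E i j) : E i (j + 1) := d' x *~ n.

Lemma rescale_d'_zmod_morphism i j : zmod_morphism (@rescale_d' i j).
Proof. by move=> x y; rewrite /rescale_d' raddfB mulrzBl. Qed.
HB.instance Definition _ i j :=
  GRing.isZmodMorphism.Build (E i j) (E i (j + 1)) (@rescale_d' i j)
    (@rescale_d'_zmod_morphism i j).

Lemma rescale_d'd' i j (x : E i j) : rescale_d' (rescale_d' x) = 0.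
Proof. by rewrite /rescale_d' raddfMz dplx_d'd' !mul0rz. Qed.

Lemma rescale_dC i j (x : E i j) : d (rescale_d' x) + rescale_d' (d x) = 0.
Proof. by rewrite /rescale_d' raddfMz -mulrzDl dplx_dC mul0rz. Qed.

Definition rescale : double_complex :=
  @DoubleComplex (dplx_obj E) (@dplx_d E) (fun i j => @rescale_d' i j)
    (@dplx_dd E) rescale_d'd' rescale_dC.

End Rescale.

Section Subquotient.
Variables (V : zmodType) (Z B : zmodClosed V).

Record cycle := Cycle { cycle_val : V; _ : cycle_val \in Z }.
HB.instance Definition _ := [isSub for cycle_val].
HB.instance Definition _ := [Choice of cycle by <:].
HB.instance Definition _ := [SubChoice_isSubZmodule of cycle by <:].

Definition boundary : {pred cycle} := [pred x | val x \in B].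
Lemma boundary_zmod_closed : zmod_closed boundary.
Proof.
split=> [|x y]; rewrite !inE; first by rewrite raddf0 rpred0.
by move=> xB yB; rewrite raddfB rpredB.
Qed.
HB.instance Definition _ :=
  GRing.isZmodClosed.Build cycle boundary boundary_zmod_closed.

(* Z / (B :&: Z) *)
Definition subquot : zmodType := Quotient.quot boundary.

Definition subquot_class (z : cycle) : subquot := \pi_(Quotient.quot boundary) z.

Definition represents (x : V) (e : subquot) : Prop :=
  exists2 z : cycle, val z = x & subquot_class z = e.

Lemma subquot_class_eq z z' :
  subquot_class z = subquot_class z' <-> val z - val z' \in B.
Proof.
rewrite /subquot_class -raddfB; split=> [h|h].
  by have /eqP := h; rewrite -Quotient.idealrBE inE.
by apply/eqP; rewrite -Quotient.idealrBE inE.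
Qed.

Lemma subquot_classB z z' :
  subquot_class (z - z') = subquot_class z - subquot_class z'.
Proof. exact: (raddfB (\pi_(Quotient.quot boundary))). Qed.

Lemma subquot_class_repr (e : subquot) : subquot_class (repr e) = e.
Proof. exact: reprK. Qed.

End Subquotient.

Section SpectralSequence.
Variable E : double_complex.

(* Equality of elements of E i j and E i' j' whose bidegrees are equal but not
   convertible, such as i - k + 1 and i - (k + 1) + 1 + 1. It asserts both
   (i, j) = (i', j') and that x is y transported along this equality. *)
Definition heq i j i' j' (x : E i j) (y : E i' j') : Prop :=
  Tagged (fun p : int * int => E p.1 p.2) (x : E (i, j).1 (i, j).2) =
  Tagged (fun p : int * int => E p.1 p.2) (y : E (i', j').1 (i', j').2).
Local Notation "x ~= y" := (heq x y) (at level 70).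

(* The chain x = x_1, ..., x_r; the entries x_k with k = 0 or k > r are
   irrelevant. *)
Definition staircase r i j (x : E i j)
    (xs : forall k : nat, E (i - k%:Z + 1) (j + k%:Z - 1)) : Prop :=
  [/\ xs 1%N ~= x, (0 < r)%N -> d x = 0
    & forall k, (0 < k < r)%N -> d (xs k.+1) ~= - d' (xs k)].

(* y is the value d x (r = 0) or d' x_r (r > 0) given by some chain. *)
Definition zigzag r i j (x : E i j) i' j' (y : E i' j') : Prop :=
  exists2 xs, staircase r x xs & if r is 0 then y ~= d x else y ~= d' (xs r).

Definition Zr r i j : {pred E i j} :=
  fun x => `[< exists xs, staircase r x xs >].

(* B_{r+1} consists of the elements representing an element of the image of
   d_r : E_r^{i+r-1,j-r} -> E_r^{i,j}. *)
Fixpoint Br_prop r i j (y : E i j) : Prop :=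
  if r is s.+1 then
    exists (x : E (i + s%:Z - 1) (j - s%:Z)) (y0 : E i j),
      zigzag s x y0 /\ Br_prop s (y - y0)
  else y = 0.
Definition Br r i j : {pred E i j} := fun y => `[< Br_prop r y >].

Arguments Zr r i j : clear implicits.
Arguments Br r i j : clear implicits.

Lemma heq_refl i j (x : E i j) : x ~= x. Proof. by []. Qed.

Lemma heq_sym i j i' j' (x : E i j) (y : E i' j') : x ~= y -> y ~= x.
Proof. by rewrite /heq => ->. Qed.

Lemma heq_trans i j i' j' i'' j'' (x : E i j) (y : E i' j') (z : E i'' j'') :
  x ~= y -> y ~= z -> x ~= z.
Proof. by rewrite /heq => ->. Qed.

Lemma heq_eq i j (x y : E i j) : x ~= y <-> x = y.
Proof.
split=> [/eqP h|->//].
by move: h; rewrite eq_Tagged => /eqP.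
Qed.

Lemma heq_elim i j (x : E i j) (P : forall i' j', E i' j' -> Prop) :
  P i j x -> forall i' j' (y : E i' j'), x ~= y -> P i' j' y.
Proof.
pose Q (t : {p : int * int & E p.1 p.2}) := P (tag t).1 (tag t).2 (tagged t).
move=> Px i' j' y xy.
pose ty := Tagged (fun p : int * int => E p.1 p.2) (y : E (i', j').1 (i', j').2).
by rewrite -[P _ _ _]/(Q ty) /ty -xy.
Qed.

Lemma heq_deg i j i' j' (x : E i j) (y : E i' j') : x ~= y -> i = i' /\ j = j'.
Proof. by move=> xy; pattern i', j', y; apply: heq_elim xy. Qed.

Lemma heq_d i j i' j' (x : E i j) (y : E i' j') : x ~= y -> d x ~= d y.
Proof. by move=> xy; pattern i', j', y; apply: heq_elim xy. Qed.

Lemma heq_d' i j i' j' (x : E i j) (y : E i' j') : x ~= y -> d' x ~= d' y.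
Proof. by move=> xy; pattern i', j', y; apply: heq_elim xy. Qed.

Lemma heqN i j i' j' (x : E i j) (y : E i' j') : x ~= y -> - x ~= - y.
Proof. by move=> xy; pattern i', j', y; apply: heq_elim xy. Qed.

Lemma heqD i j i' j' (x u : E i j) (y v : E i' j') :
  x ~= y -> u ~= v -> x + u ~= y + v.
Proof.
move=> xy; move: v; pattern i', j', y; apply: heq_elim xy => v /heq_eq ->.
exact: heq_refl.
Qed.

Lemma heqB i j i' j' (x u : E i j) (y v : E i' j') :
  x ~= y -> u ~= v -> x - u ~= y - v.
Proof. by move=> xy uv; apply: heqD => //; apply: heqN. Qed.

Definition transport i j i' j' (ei : i = i') (ej : j = j')
    (x : E i j) : E i' j' :=
  ecast i (E i j') ei (ecast j (E i j) ej x).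

Lemma transportP i j i' j' (ei : i = i') (ej : j = j') (x : E i j) :
  x ~= transport ei ej x.
Proof. by case: _ / ei; case: _ / ej. Qed.

Lemma heq0 i j i' j' : i = i' -> j = j' -> (0 : E i j) ~= (0 : E i' j').
Proof. by move=> -> ->. Qed.

Lemma staircaseB r i j (x y : E i j) xs ys :
  staircase r x xs -> staircase r y ys ->
  staircase r (x - y) (fun k => xs k - ys k).
Proof.
case=> x1 dx xk [y1 dy yk]; split; first exact: heqB.
  by move=> r0; rewrite raddfB dx // dy // subr0.
by move=> k kr; rewrite !raddfB; apply: heqB; [apply: xk | apply: yk].
Qed.

Lemma staircase0 r i j : staircase r (0 : E i j) (fun=> 0).
Proof.
split=> [|_|k kr]; rewrite ?raddf0 //; first by apply: heq0; lia.
by apply: heq0; lia.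
Qed.

Lemma zigzagB r i j (x x' : E i j) i' j' (y y' : E i' j') :
  zigzag r x y -> zigzag r x' y' -> zigzag r (x - x') (y - y').
Proof.
case=> xs xsP xsy [ys ysP ysy]; exists (fun k => xs k - ys k).
  exact: staircaseB.
by case: r {xsP ysP} xsy ysy => [|r] xy ysy; rewrite raddfB; apply: heqB.
Qed.

Lemma zigzag0 r i j i' j' : i' = i - r%:Z + 1 -> j' = j + r%:Z ->
  zigzag r (0 : E i j) (0 : E i' j').
Proof.
move=> -> ->; exists (fun=> 0); first exact: staircase0.
by case: r => [|r]; rewrite raddf0; apply: heq0; lia.
Qed.

Lemma zigzag_heql r a b i j (x : E a b) (u : E i j) i' j' (y : E i' j') :
  x ~= u -> zigzag r x y -> zigzag r u y.
Proof. by move=> xu; pattern i, j, u; apply: heq_elim xu. Qed.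

Lemma zigzag_heqr r i j (x : E i j) i' j' (y : E i' j') a b (v : E a b) :
  y ~= v -> zigzag r x y -> zigzag r x v.
Proof. by move=> yv; pattern a, b, v; apply: heq_elim yv. Qed.

Lemma zigzag_deg r i j (x : E i j) i' j' (y : E i' j') :
  zigzag r x y -> i' = i - r%:Z + 1 /\ j' = j + r%:Z.
Proof. by case=> xs _; case: r xs => [|r] xs /heq_deg[-> ->]; split; lia. Qed.

Lemma zigzag_exists r i j (x : E i j) : x \in Zr r i j ->
  exists y : E (i - r%:Z + 1) (j + r%:Z), zigzag r x y.
Proof.
move=> /asboolP[xs xsP]; case: r xsP => [|r] xsP.
  have ei : i + 1 = i - 0%:Z + 1 by lia.
  have ej : j = j + 0%:Z by lia.
  exists (transport ei ej (d x)); exists xs => //.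
  exact/heq_sym/transportP.
have ej : j + r.+1%:Z - 1 + 1 = j + r.+1%:Z by lia.
exists (transport erefl ej (d' (xs r.+1))); exists xs => //.
exact/heq_sym/transportP.
Qed.

Lemma Zr_zmod_closed r i j : zmod_closed (Zr r i j).
Proof.
split=> [|x y].
  by apply/asboolP; exists (fun=> 0); apply: staircase0.
move=> /asboolP[xs xsP] /asboolP[ys ysP]; apply/asboolP.
by exists (fun k => xs k - ys k); apply: staircaseB.
Qed.
HB.instance Definition _ r i j :=
  GRing.isZmodClosed.Build (E i j) (Zr r i j) (@Zr_zmod_closed r i j).

Lemma Br_zmod_closed r i j : zmod_closed (Br r i j).
Proof.
elim: r => [|r [IH0 IHB]].
  split=> [|x y]; first exact/asboolP.
  by move=> /asboolP-> /asboolP->; apply/asboolP; rewrite subrr.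
split=> [|y y'].
  apply/asboolP; exists 0, 0; split; first by apply: zigzag0; lia.
  by rewrite subr0; apply/asboolP.
move=> /asboolP[x [u [xu /asboolP yu]]] /asboolP[x' [u' [xu' /asboolP yu']]].
apply/asboolP; exists (x - x'), (u - u'); split; first exact: zigzagB.
apply/asboolP; rewrite opprB [u' - u]addrC addrACA [- y' + u']addrC.
by rewrite -[u' - y']opprB; apply: IHB.
Qed.
HB.instance Definition _ r i j :=
  GRing.isZmodClosed.Build (E i j) (Br r i j) (@Br_zmod_closed r i j).

Lemma Br_zigzag r a b (x : E a b) i j (y u : E i j) :
  zigzag r x u -> y - u \in Br r i j -> y \in Br r.+1 i j.
Proof.
move=> xu /asboolP yu; apply/asboolP.
have [ei ej] := zigzag_deg xu.
have ea : a = i + r%:Z - 1 by lia.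
have eb : b = j - r%:Z by lia.
exists (transport ea eb x), u; split => //.
by apply: zigzag_heql xu; apply: transportP.
Qed.

Lemma Br_decomp r i j (y : E i j) : y \in Br r.+1 i j ->
  exists (w : E (i - 1) j) (z : E i (j - 1)) (y1 y2 : E i j),
    [/\ y = y1 + y2, y1 ~= d w & y2 ~= d' z].
Proof.
elim: r y => [|r IHr] y /asboolP[x [u [[xs [_ dx xk] ux]]]].
  move=> /= /eqP; rewrite subr_eq0 => /eqP ->.
  have ei : i + 0%:Z - 1 = i - 1 by lia.
  have ej : j - 0%:Z = j by lia.
  exists (transport ei ej x), 0, u, 0; split; first by rewrite addr0.
    by apply: heq_trans ux _; apply/heq_d/transportP.
  by rewrite raddf0; apply: heq0; lia.
move=> /asboolP /IHr[w [z [y1 [y2 [yuE y1w y2z]]]]].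
have ei : i + r.+1%:Z - 1 - r.+1%:Z + 1 = i by lia.
have ej : j - r.+1%:Z + r.+1%:Z - 1 = j - 1 by lia.
pose t := transport ei ej (xs r.+1).
exists w, (z + t), y1, (y2 + u); split => //.
  by rewrite addrA -yuE subrK.
rewrite raddfD; apply: heqD => //.
by apply: heq_trans ux _; apply/heq_d'/transportP.
Qed.

Lemma d'd_heq i j (x : E i j) : d' (d x) = - d (d' x).
Proof. by apply/eqP; rewrite -addr_eq0 [d' _ + _]addrC dplx_dC. Qed.

Fact single_degi (i : int) : i = i - 1%N%:Z + 1. Proof. by lia. Qed.
Fact single_degj (j : int) : j = j + 1%N%:Z - 1. Proof. by lia. Qed.

Definition single i j (x : E i j) (k : nat) : E (i - k%:Z + 1) (j + k%:Z - 1) :=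
  if k is 1%N then transport (single_degi i) (single_degj j) x else 0.

Lemma staircase_single i j (x : E i j) : staircase 0 x (single x).
Proof.
by split=> // [|k /andP[]]; [apply/heq_sym/transportP | lia].
Qed.

(* This makes d_r well defined on classes. *)
Lemma zigzag_Br r i j (x : E i j) i' j' (y : E i' j') :
  zigzag r x y -> x \in Br r i j -> y \in Br r i' j'.
Proof.
case: r => [|r].
  case=> xs _ yx /asboolP /= x0; apply/asboolP => /=; apply/heq_eq.
  have [ei ej] := heq_deg yx.
  by apply: heq_trans yx _; rewrite x0 raddf0; apply: heq0.
case=> xs [x1 dx xk] yx /Br_decomp[w [z [u1 [u2 [xE u1w u2z]]]]].
have d'x : d' x ~= - d (d' w).
  rewrite xE raddfD -d'd_heq -[d' (d w)]addr0.
  apply: heqD; first exact: heq_d'.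
  apply: heq_trans (heq_d' u2z) _; rewrite dplx_d'd'.
  by apply: heq0; have [] := heq_deg u1w; have [] := heq_deg u2z; lia.
case: r dx xk yx => [|r] dx xk yx.
  apply: (@Br_zigzag 0 _ _ (- d' w) _ _ y y); last by rewrite subrr rpred0.
  exists (single (- d' w)); first exact: staircase_single.
  by apply: heq_trans yx _; rewrite raddfN; apply: heq_trans d'x; apply: heq_d'.
have e1 k : i - k.+1%:Z + 1 = i - 1 - k%:Z + 1 by lia.
have e2 k : j + k.+1%:Z - 1 = j + 1 + k%:Z - 1 by lia.
have e3 : i - 2%:Z + 1 = i - 1 by lia.
have e4 : j + 2%:Z - 1 = j + 1 by lia.
pose v := transport e3 e4 (xs 2) - d' w.
pose vs k := transport (e1 k) (e2 k) (xs k.+1) - single (d' w) k.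
apply: (@Br_zigzag r.+1 _ _ v _ _ y y); last by rewrite subrr rpred0.
have d's k : d' (single (d' w) k) = 0.
  case: k => [|[|k]] /=; rewrite ?raddf0 //; apply/heq_eq.
  apply: heq_trans (heq_d' (heq_sym (transportP _ _ _))) _.
  by rewrite dplx_d'd'; apply: heq0; lia.
exists vs; last first.
  by apply: heq_trans yx _; rewrite raddfB d's subr0; apply/heq_d'/transportP.
split.
- apply: heqB; last exact/heq_sym/transportP.
  by apply: heq_trans (transportP _ _ _); apply/heq_sym/transportP.
- move=> _; rewrite raddfB; apply/eqP; rewrite subr_eq0; apply/eqP/heq_eq.
  apply: heq_trans (heq_d (heq_sym (transportP _ _ _))) _.
  apply: heq_trans (xk 1%N isT) _; rewrite -[d (d' w)]opprK; apply: heqN.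
  by apply: heq_trans d'x; apply: heq_d'.
- move=> k kr; rewrite !raddfB d's raddf0 subr0.
  case: k kr => // k kr; rewrite [single _ _]/= raddf0 subr0.
  apply: heq_trans (heq_d (heq_sym (transportP _ _ _))) _.
  apply: heq_trans (xk k.+2 _) _; first by lia.
  by apply/heqN/heq_d'/transportP.
Qed.

Lemma zigzag_Zr r i j (x : E i j) i' j' (y : E i' j') :
  zigzag r x y -> y \in Zr r i' j'.
Proof.
move=> [xs [x1 dx xk] yx]; apply/asboolP; exists (single y).
case: r dx xk yx => [|r] dx xk yx; first exact: staircase_single.
have {}dx := dx isT.
have dy : d y = 0.
  apply/heq_eq; apply: heq_trans (heq_d yx) _.
  have [ei ej] := heq_deg yx.
  have /heqN : d' (d (xs r.+1)) ~= (0 : E (i' + 1) j').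
    case: r xk {yx} ei ej => [|r] xk ei ej.
      apply: heq_trans (heq_d' (heq_d x1)) _.
      by rewrite dx // raddf0; apply: heq0; lia.
    apply: heq_trans (heq_d' (xk r.+1 _)) _; first by lia.
    by rewrite raddfN dplx_d'd' oppr0; apply: heq0; lia.
  by rewrite d'd_heq opprK oppr0.
split=> //; first exact/heq_sym/transportP.
case=> // -[|k] kr /=; rewrite raddf0; last first.
  by rewrite raddf0 oppr0; apply: heq0; lia.
have [ei ej] := heq_deg yx.
apply: (@heq_trans _ _ _ _ _ _ _ (- d' y)); last by apply/heqN/heq_d'/transportP.
apply: heq_sym; apply: heq_trans (heqN (heq_d' yx)) _.
by rewrite dplx_d'd' oppr0; apply: heq0; lia.
Qed.

Definition page r i j : zmodType := subquot (Zr r i j) (Br r i j).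

Lemma diff_exists r i j (e : page r i j) :
  exists y : E (i - r%:Z + 1) (j + r%:Z), zigzag r (val (repr e)) y.
Proof. exact/zigzag_exists/valP. Qed.

Definition diff_lift r i j (e : page r i j) : cycle (Zr r _ _) :=
  Cycle (zigzag_Zr (projT2 (cid (diff_exists e)))).

Definition diff r i j (e : page r i j) : page r (i - r%:Z + 1) (j + r%:Z) :=
  subquot_class (Br r _ _) (diff_lift e).

(* d_r is independent of the choices made in [diff_lift]. *)
Lemma diffP r i j (x : E i j) (e : page r i j)
    (y : E (i - r%:Z + 1) (j + r%:Z)) :
  represents x e -> zigzag r x y -> represents y (diff e).
Proof.
case=> z <- ze zy; exists (Cycle (zigzag_Zr zy)) => //.
apply/subquot_class_eq => /=; case: cid => u /= zu.
apply: zigzag_Br (zigzagB zy zu) _.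
by apply/subquot_class_eq; rewrite ze subquot_class_repr.
Qed.

Lemma diff_zmod_morphism r i j : zmod_morphism (@diff r i j).
Proof.
move=> e f; have [y ey] := diff_exists e; have [u fu] := diff_exists f.
have re (g : page r i j) : represents (val (repr g)) g.
  by exists (repr g) => //; apply: subquot_class_repr.
have [z zy <-] := diffP (re e) ey.
have [w wu <-] := diffP (re f) fu.
have : represents (val (repr e) - val (repr f)) (e - f).
  exists (repr e - repr f); first exact: raddfB.
  by rewrite subquot_classB !subquot_class_repr.
move=> /diffP /(_ (zigzagB ey fu)) [t tE <-]; rewrite -subquot_classB.
by apply/subquot_class_eq; rewrite tE -zy -wu -(raddfB val) subrr rpred0.
Qed.
HB.instance Definition _ r i j :=
  GRing.isZmodMorphism.Build (page r i j) (page r (i - r%:Z + 1) (j + r%:Z))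
    (@diff r i j) (@diff_zmod_morphism r i j).

End SpectralSequence.

(* Main.v *)
Require Import Defs.
From mathcomp Require Import all_boot all_order all_algebra.
From mathcomp Require Import boolp.

(** Why the theorem holds: if [x = x_1, x_2, ..., x_r] is a chain for [x] in
    [E], then [x_1, n x_2, ..., n^(r-1) x_r] is a chain for [x] in the rescaled
    complex, since each step of a chain trades one [d] against one [d'], and
    the latter has been multiplied by [n]. Its last term is sent by [n d'] to
    [n^r d' x_r], so multiplication by [n^r] takes values of [d_r] at [x] to
    values of the rescaled [d_r] at [x] ([zigzag_rescale]).

    This settles the formula for one representative of [d_r x]. Any other
    representative differs from it by an element [b] of [B_r], and one must see
    that [n^r b] is a boundary for the rescaled complex ([Br_rescale]): [b] is
    a sum of values of [d_s] for [s < r], and [n^r] times such a value is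
    [n^(r-s)] times a value of the rescaled [d_s]. *)

Import GRing.Theory.
Local Open Scope ring_scope.

Lemma heqMz {E : double_complex} {i j i' j' : int} {x : E i j} {y : E i' j'}
    (m : int) :
  heq x y -> heq (x *~ m) (y *~ m).
Proof. by move=> xy; pattern i', j', y; apply: heq_elim xy. Qed.

Lemma represents_Z {V : zmodType} {Z B : zmodClosed V} {x : V}
    {e : subquot Z B} :
  represents x e -> x \in Z.
Proof. by case=> z <- _; apply: valP. Qed.

Lemma represents_congr {V : zmodType} {Z B : zmodClosed V} {x y : V}
    {e : subquot Z B} :
  represents x e -> y \in Z -> y - x \in B -> represents y e.
Proof.
case=> z <- <- yZ yzB; exists (Cycle yZ) => //.
exact/subquot_class_eq.
Qed.

Lemma represents_sub {V : zmodType} {Z B : zmodClosed V} {x y : V}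
    {e : subquot Z B} :
  represents x e -> represents y e -> x - y \in B.
Proof. by case=> z <- <- [w <- /esym/subquot_class_eq]. Qed.

Section Rescale.
Context {E : double_complex} (n : int).

(** The exponent [k.-1] is the number of [d'] used to reach [x_k] from
    [x = x_1]. *)
Lemma staircase_rescale {r : nat} {i j : int} {x : E i j} {xs} :
  staircase r x xs ->
  @staircase (rescale n E) r i j x (fun k => xs k *~ n ^+ k.-1).
Proof.
case=> x1 dx xk; split=> // -[//|k] kr.
rewrite [X in heq X _](raddfMz (@dplx_d E _ _)).
rewrite [X in heq _ (- X)](_ : _ = dplx_d' E _ _ (xs k.+1) *~ n ^+ k.+1).
  by rewrite -mulNrz; apply: heqMz; apply: xk.
by rewrite /= /rescale_d' raddfMz -mulrzA -exprSr.
Qed.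

Lemma zigzag_rescale {r : nat} {i j i' j' : int} {x : E i j} {y : E i' j'} :
  zigzag r x y ->
  @zigzag (rescale n E) r i j x i' j' (y *~ n ^+ r).
Proof.
case=> xs /staircase_rescale xsP yx; exists (fun k => xs k *~ n ^+ k.-1) => //.
case: r {xsP} yx => [//|r] yx.
rewrite [X in heq _ X](_ : _ = dplx_d' E _ _ (xs r.+1) *~ n ^+ r.+1).
  exact: heqMz.
by rewrite /= /rescale_d' raddfMz -mulrzA -exprSr.
Qed.

Lemma Zr_rescale {r : nat} {i j : int} {x : E i j} :
  x \in @Zr E r i j -> x \in @Zr (rescale n E) r i j.
Proof.
move=> /asboolP[xs /staircase_rescale xsP].
by apply/asboolP; exists (fun k => xs k *~ n ^+ k.-1).
Qed.

(** Modulo [B_r] an element of [B_(r+1)] is a value of [d_r], which [n^r]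
    turns into a value of the rescaled [d_r]; the remaining factor [n] is
    harmless because [B_(r+1)] is a subgroup. *)
Lemma Br_rescale {r : nat} {i j : int} {y : E i j} :
  y \in @Br E r i j ->
  (y *~ n ^+ r : rescale n E i j) \in @Br (rescale n E) r i j.
Proof.
elim: r y => [|r IHr] y /asboolP.
  by move=> /= ->; apply/asboolP; rewrite /= mul0rz.
case=> x [u [xu /asboolP yu]].
rewrite exprSr mulrzA; apply: rpredMz.
apply: Br_zigzag (zigzag_rescale xu) _.
by rewrite -(mulrzBl y u (n ^+ r)); apply: IHr.
Qed.

End Rescale.

Theorem lemma1p1 (E : double_complex) (n : int) (r : nat) (i j : int)
    (x : E i j) (e : page E r i j) (xe : represents x e) :
  (exists e' : page (rescale n E) r i j, represents (x : rescale n E i j) e') /\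
  (forall e' : page (rescale n E) r i j, represents (x : rescale n E i j) e' ->
   forall y : E (i - r%:Z + 1) (j + r%:Z),
     represents y (diff e) ->
     represents (y *~ (n ^+ r) : rescale n E (i - r%:Z + 1) (j + r%:Z)) (diff e')).
Proof.
have xZ := represents_Z xe.
split.
  have xZ' := Zr_rescale n xZ.
  by exists (subquot_class (@Br (rescale n E) r i j) (Cycle xZ')), (Cycle xZ').
move=> e' xe' y ye; have [y0 xy0] := zigzag_exists xZ.
apply: represents_congr (diffP xe' (zigzag_rescale n xy0)) _ _.
  by apply: rpredMz; apply: Zr_rescale (represents_Z ye).
rewrite -(mulrzBl y y0 (n ^+ r)); apply: Br_rescale.
exact: represents_sub ye (diffP xe xy0).
Qed.
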